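(* Let $H=(H,\Delta,\varepsilon,\Phi,\alpha,\beta,S)$ be a finite-dimensional split semi-simple quasi-Hopf algebra over a field $k$. Then there exists an invertible element $u$ of $H$ such that the antipode $S_u$ of $H_u$ is an involution, i.e. $S_u^2=id_H$.
   Context: A quasi-bialgebra over a field $k$ is $(H,\Delta,\varepsilon,\Phi)$ with $H$ a unital associative $k$-algebra, $\Delta:H\to H\otimes H$ and $\varepsilon:H\to k$ algebra maps, and $\Phi\in H\otimes H\otimes H$ invertible such that $(\varepsilon\otimes id)\Delta=id=(id\otimes\varepsilon)\Delta$; $\Phi(\Delta\otimes id)\Delta(h)\Phi^{-1}=(id\otimes\Delta)\Delta(h)$ for all $h$; $(id\otimes id\otimes\Delta)(\Phi)(\Delta\otimes id\otimes id)(\Phi)=(1\otimes\Phi)(id\otimes\Delta\otimes id)(\Phi)(\Phi\otimes1)$; $(id\otimes\varepsilon\otimes id)(\Phi)=1\otimes1$. Write $\Delta(h)=\sum h_1\otimes h_2$, $\Phi=\sum X_i\otimes Y_i\otimes Z_i$, $\Phi^{-1}=\sum\overline X_i\otimes\overline Y_i\otimes\overline Z_i$. A quasi-Hopf algebra $(H,\Delta,\varepsilon,\Phi,\alpha,\beta,S)$ is a quasi-bialgebra with an algebra anti-automorphism $S$ (the antipode) and $\alpha,\beta\in H$ such that for all $h\in H$: $\sum S(h_1)\alpha h_2=\varepsilon(h)\alpha$, $\sum h_1\beta S(h_2)=\varepsilon(h)\beta$, $\sum X_i\beta S(Y_i)\alpha Z_i=1$, $\sum S(\overline X_i)\alpha\overline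 Y_i\beta S(\overline Z_i)=1$. For a unit $u\in H$, $H_u=(H,\Delta,\varepsilon,\Phi,u\alpha,\beta u^{-1},S_u)$, where $S_u(h)=uS(h)u^{-1}$ for all $h\in H$; this is again a quasi-Hopf algebra. ''Split semi-simple over $k$'' means isomorphic as a $k$-algebra to a finite direct sum of full matrix algebras over $k$. *)

(* Defs.v *)
From HB Require Import structures.
From mathcomp Require Import all_boot all_algebra all_field.

Set Implicit Arguments.
Unset Strict Implicit.
Unset Printing Implicit Defensive.

Import GRing.Theory.
Local Open Scope ring_scope.

(* The tensor product over k of finite-dimensional spaces, in coordinates:    *)
(* t i j is the coefficient of e_i (x) e_j, for the bases e := vbasis {:_}.   *)
(* The choice of bases is immaterial, as tens_ind, tliftE and tlift_uniq give *)
(* the universal property.                                                    *)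
Definition tens (k : fieldType) (U V : vectType k) : Type :=
  'M[k]_(\dim {:U}, \dim {:V}).

Section TensorSpace.
Variable k : fieldType.
Implicit Types U V W : vectType k.

HB.instance Definition _ U V := Vector.on (tens U V).

Definition tpure U V (u : U) (v : V) : tens U V :=
  \matrix_(i, j) (coord (vbasis {:U}) i u * coord (vbasis {:V}) j v).

(* The linear map on U (x) V induced by f; meaningful for bilinear f only. *)
Definition tlift U V (W : lmodType k) (f : U -> V -> W) (t : tens U V) : W :=
  \sum_i \sum_j t i j *: f (vbasis {:U})`_i (vbasis {:V})`_j.

Definition bilin U V (W : lmodType k) (f : U -> V -> W) : Prop :=
  (forall v, linear (f^~ v)) /\ (forall u, linear (f u)).

Lemma tpureDl U V (u u' : U) (v : V) :
  tpure (u + u') v = tpure u v + tpure u' v.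
Proof. by apply/matrixP=> i j; rewrite !mxE linearD mulrDl. Qed.

Lemma tpureDr U V (u : U) (v v' : V) :
  tpure u (v + v') = tpure u v + tpure u v'.
Proof. by apply/matrixP=> i j; rewrite !mxE linearD mulrDr. Qed.

Lemma tpureZl U V a (u : U) (v : V) : tpure (a *: u) v = a *: tpure u v.
Proof. by apply/matrixP=> i j; rewrite !mxE linearZ /= mulrA. Qed.

Lemma tpureZr U V a (u : U) (v : V) : tpure u (a *: v) = a *: tpure u v.
Proof. by apply/matrixP=> i j; rewrite !mxE linearZ /= mulrCA. Qed.

Lemma tpure_bilin U V : bilin (@tpure U V).
Proof.
by split=> [v a u u'|u a v v']; rewrite ?tpureDl ?tpureZl ?tpureDr ?tpureZr.
Qed.

Lemma tlift_linear U V (W : lmodType k) (f : U -> V -> W) : linear (tlift f).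
Proof.
move=> a s t; rewrite /tlift scaler_sumr -big_split; apply: eq_bigr => i _.
rewrite scaler_sumr -big_split; apply: eq_bigr => j _ /=.
by rewrite !mxE scalerDl scalerA.
Qed.

HB.instance Definition _ U V (W : lmodType k) (f : U -> V -> W) :=
  GRing.isLinear.Build k (tens U V) W _ (tlift f) (@tlift_linear U V W f).

Lemma eq_tlift U V (W : lmodType k) (f g : U -> V -> W) :
  f =2 g -> tlift f =1 tlift g.
Proof.
by move=> fg t; apply: eq_bigr => i _; apply: eq_bigr => j _; rewrite fg.
Qed.

Lemma tliftD U V (W : lmodType k) (f g : U -> V -> W) t :
  tlift (fun u v => f u v + g u v) t = tlift f t + tlift g t.
Proof.
rewrite /tlift -big_split; apply: eq_bigr => i _.
by rewrite -big_split; apply: eq_bigr => j _; rewrite scalerDr.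
Qed.

Lemma tlift_comp U V (W W' : lmodType k) (g : {linear W -> W'})
    (f : U -> V -> W) t :
  tlift (fun u v => g (f u v)) t = g (tlift f t).
Proof.
rewrite /tlift linear_sum; apply: eq_bigr => i _.
by rewrite linear_sum; apply: eq_bigr => j _; rewrite linearZ.
Qed.

Lemma coord_sum U (u : U) :
  u = \sum_i coord (vbasis {:U}) i u *: (vbasis {:U})`_i.
Proof. exact: coord_vbasis (memvf u). Qed.

Lemma tliftE U V (W : lmodType k) (f : U -> V -> W) u v :
  bilin f -> tlift f (tpure u v) = f u v.
Proof.
move=> [fl fr].
have suml n (c : 'I_n -> k) (x : 'I_n -> U) w :
    f (\sum_i c i *: x i) w = \sum_i c i *: f (x i) w.
  pose g := GRing.isLinear.Build k U W _ (f^~ w) (fl w).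
  pose h : {linear U -> W} := HB.pack (f^~ w) g.
  by rewrite -[LHS]/(h _) linear_sum; apply: eq_bigr => i _; rewrite linearZ.
have sumr n (c : 'I_n -> k) (x : 'I_n -> V) w :
    f w (\sum_i c i *: x i) = \sum_i c i *: f w (x i).
  pose g := GRing.isLinear.Build k V W _ (f w) (fr w).
  pose h : {linear V -> W} := HB.pack (f w) g.
  by rewrite -[LHS]/(h _) linear_sum; apply: eq_bigr => i _; rewrite linearZ.
rewrite {2}(coord_sum u) suml; apply: eq_bigr => i _.
rewrite {2}(coord_sum v) sumr scaler_sumr; apply: eq_bigr => j _.
by rewrite mxE scalerA.
Qed.

Lemma coord_basis U (i j : 'I_(\dim {:U})) :
  coord (vbasis {:U}) i (vbasis {:U})`_j = (j == i)%:R.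
Proof. exact: coord_free (basis_free (vbasisP _)). Qed.

Lemma tens_sum U V (t : tens U V) :
  t = \sum_i \sum_j t i j *: tpure (vbasis {:U})`_i (vbasis {:V})`_j.
Proof.
apply/matrixP=> i j; rewrite summxE (bigD1 i) //= [X in _ + X]big1 ?addr0.
  rewrite summxE (bigD1 j) //= big1 ?addr0 => [|j' jj'].
    by rewrite !mxE !coord_basis !eqxx !mulr1.
  by rewrite !mxE !coord_basis (negPf jj') !mulr0.
move=> i' ii'; rewrite summxE big1 // => j' _.
by rewrite !mxE !coord_basis (negPf ii') mul0r mulr0.
Qed.

Lemma tens_ind U V (P : tens U V -> Prop) :
  P 0 -> (forall s t, P s -> P t -> P (s + t)) ->
  (forall u v, P (tpure u v)) -> forall t, P t.
Proof.
move=> P0 PD Pp t; rewrite (tens_sum t).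
apply: big_ind => // i _; apply: big_ind => // j _.
by rewrite -tpureZl.
Qed.

Lemma tlift_uniq U V (W : lmodType k) (f : U -> V -> W)
    (g : {linear tens U V -> W}) :
  (forall u v, g (tpure u v) = f u v) -> g =1 tlift f.
Proof.
move=> gf t; rewrite [in LHS](tens_sum t) linear_sum; apply: eq_bigr => i _.
by rewrite linear_sum; apply: eq_bigr => j _; rewrite linearZ gf.
Qed.

Definition tmap U U' V V' (f : U -> U') (g : V -> V') :
    tens U V -> tens U' V' :=
  tlift (fun u v => tpure (f u) (g v)).

Definition tassoc U V W : tens (tens U V) W -> tens U (tens V W) :=
  tlift (fun s w => tlift (fun u v => tpure u (tpure v w)) s).

Lemma tmapE U U' V V' (f : {linear U -> U'}) (g : {linear V -> V'}) u v :
  tmap f g (tpure u v) = tpure (f u) (g v).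
Proof.
rewrite /tmap tliftE //; split=> [w a x y|w a x y]; rewrite linearP.
  by rewrite tpureDl tpureZl.
by rewrite tpureDr tpureZr.
Qed.

Lemma tassocE U V W (u : U) (v : V) (w : W) :
  tassoc (tpure (tpure u v) w) = tpure u (tpure v w).
Proof.
have E (w' : W) : tlift (fun u v => tpure u (tpure v w')) (tpure u v)
    = tpure u (tpure v w').
  apply: tliftE; split=> [x a y z|x a y z].
    by rewrite tpureDl tpureZl.
  by rewrite tpureDl tpureZl tpureDr tpureZr.
rewrite /tassoc tliftE ?E //; split=> [x a y z|x a y z]; first exact: linearP.
rewrite -[_ *: _]/(GRing.scale a _) -(tlift_comp (GRing.scale a)) -tliftD.
by apply: eq_tlift => u' v'; rewrite /= !(tpureDr, tpureZr).
Qed.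

End TensorSpace.

Section TensorAlgebra.
Variables (k : fieldType) (A B : falgType k).

Definition tone : tens A B := tpure 1 1.

(* (a (x) b) (c (x) d) = ac (x) bd *)
Definition tmul (s t : tens A B) : tens A B :=
  tlift (fun a b => tlift (fun c d => tpure (a * c) (b * d)) t) s.

Lemma tmulDl : left_distributive tmul +%R.
Proof. by move=> s s' t; rewrite /tmul linearD. Qed.

Lemma tmulZl a s t : tmul (a *: s) t = a *: tmul s t.
Proof. by rewrite /tmul linearZ. Qed.

Lemma tmulZr a s t : tmul s (a *: t) = a *: tmul s t.
Proof.
rewrite /tmul -(tlift_comp (GRing.scale a)).
by apply: eq_tlift => b c; rewrite linearZ.
Qed.

Lemma tmulDr : right_distributive tmul +%R.
Proof.
move=> s t t'; rewrite /tmul -tliftD.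
by apply: eq_tlift => a b; rewrite linearD.
Qed.

Lemma tmulE a b c d : tmul (tpure a b) (tpure c d) = tpure (a * c) (b * d).
Proof.
have E a' b' : tlift (fun c d => tpure (a' * c) (b' * d)) (tpure c d)
    = tpure (a' * c) (b' * d).
  apply: tliftE; split=> [d' x u v|c' x u v].
    by rewrite mulrDr tpureDl -scalerAr tpureZl.
  by rewrite mulrDr tpureDr -scalerAr tpureZr.
rewrite /tmul (eq_tlift E) tliftE //.
split=> [d' x u v|c' x u v].
  by rewrite mulrDl tpureDl -scalerAl tpureZl.
by rewrite mulrDl tpureDr -scalerAl tpureZr.
Qed.

Lemma tmul0l t : tmul 0 t = 0. Proof. by rewrite /tmul linear0. Qed.
Lemma tmul0r t : tmul t 0 = 0.
Proof. by have := tmulZr 0 t 0; rewrite !scale0r. Qed.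

Lemma tmulA : associative tmul.
Proof.
move=> s t u; elim/tens_ind: s => [|s s' IHs IHs'|a b]; first by rewrite !tmul0l.
  by rewrite !tmulDl IHs IHs'.
elim/tens_ind: t => [|t t' IHt IHt'|c d]; first by rewrite tmul0r !tmul0l tmul0r.
  by rewrite !(tmulDl, tmulDr) IHt IHt'.
elim/tens_ind: u => [|u u' IHu IHu'|e f]; first by rewrite !tmul0r.
  by rewrite !tmulDr IHu IHu'.
by rewrite !tmulE !mulrA.
Qed.

Lemma tmul1l : left_id tone tmul.
Proof.
move=> t; elim/tens_ind: t => [|t t' IHt IHt'|c d]; first exact: tmul0r.
  by rewrite tmulDr IHt IHt'.
by rewrite tmulE !mul1r.
Qed.

Lemma tmul1r : right_id tone tmul.
Proof.
move=> t; elim/tens_ind: t => [|t t' IHt IHt'|c d]; first exact: tmul0l.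
  by rewrite tmulDl IHt IHt'.
by rewrite tmulE !mulr1.
Qed.

Lemma tone_neq0 : tone != 0.
Proof.
have nz (C : falgType k) : exists i, coord (vbasis {:C}) i 1 != 0.
  apply/existsP; apply: contraT; rewrite negb_exists => /forallP/= c0.
  have /eqP[] := oner_neq0 C; rewrite (coord_sum 1) big1 // => i _.
  by have /negbNE/eqP-> := c0 i; rewrite scale0r.
have [[i ai] [j bj]] := (nz A, nz B).
apply/eqP=> /matrixP/(_ i j); rewrite !mxE => /eqP.
by rewrite mulf_eq0 (negPf ai) (negPf bj).
Qed.

HB.instance Definition _ := GRing.Zmodule_isNzRing.Build (tens A B)
  tmulA tmul1l tmul1r tmulDl tmulDr tone_neq0.

Lemma tscalerAl (a : k) (s t : tens A B) : a *: (s * t) = (a *: s) * t.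
Proof. exact: esym (tmulZl _ _ _). Qed.
HB.instance Definition _ := GRing.Lmodule_isLalgebra.Build k (tens A B)
  tscalerAl.

Lemma tscalerAr (a : k) (s t : tens A B) : a *: (s * t) = s * (a *: t).
Proof. exact: esym (tmulZr _ _ _). Qed.
HB.instance Definition _ := GRing.Lalgebra_isAlgebra.Build k (tens A B)
  tscalerAr.

HB.instance Definition _ := Algebra_isFalgebra.Build k (tens A B).

Lemma tpureM (a c : A) (b d : B) :
  tpure a b * tpure c d = tpure (a * c) (b * d).
Proof. exact: tmulE. Qed.

Lemma tpure1 : tpure 1 1 = 1 :> tens A B.
Proof. by []. Qed.

End TensorAlgebra.

(* Iterated tensor products are bracketed to the right, so the associator     *)
(* tassoc is inserted wherever the identification of                          *)
(* (U (x) V) (x) W with U (x) (V (x) W) is implicit in the usual axioms.      *)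
(* A falgType is nonzero; this loses nothing, since counit 1 = 1 in k.        *)
Record quasiBialgebra (k : fieldType) (H : falgType k) := QuasiBialgebra {
  comul : {lrmorphism H -> tens H H};
  counit : {lrmorphism H -> k | *%R};
  assoc : tens H (tens H H);
  assoc_unit : assoc \is a GRing.unit;
  counit_comul : forall h, tlift (fun a b => counit a *: b) (comul h) = h;
  comul_counit : forall h, tlift (fun a b => counit b *: a) (comul h) = h;
  quasi_coassoc : forall h,
    assoc * tassoc (tmap comul idfun (comul h)) * assoc^-1
      = tmap idfun comul (comul h);
  pentagon :
    tmap idfun (tmap idfun comul) assoc * tassoc (tmap comul idfun assoc)
      = tpure 1 assoc
        * tmap idfun (@tassoc k H H H \o tmap comul idfun) assoc
        * tmap idfun (@tassoc k H H H) (tassoc (tpure assoc 1));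
  assoc_counit :
    tmap idfun (tlift (fun a b => counit a *: b)) assoc = tpure 1 1
}.

(* sum_i f(X_i, Y_i, Z_i) for t = sum_i X_i (x) Y_i (x) Z_i *)
Definition tlift3 (k : fieldType) (U V W : vectType k) (M : lmodType k)
    (f : U -> V -> W -> M) : tens U (tens V W) -> M :=
  tlift (fun x => tlift (f x)).

Record quasiHopf (k : fieldType) (H : falgType k) := QuasiHopf {
  qbialg :> quasiBialgebra H;
  qalpha : H;
  qbeta : H;
  antipode : {linear H -> H};
  antipode_bij : bijective antipode;
  antipode1 : antipode 1 = 1;
  antipodeM : forall a b, antipode (a * b) = antipode b * antipode a;
  antipode_alpha : forall h,
    tlift (fun a b => antipode a * qalpha * b) (comul qbialg h)
      = counit qbialg h *: qalpha;
  antipode_beta : forall h,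
    tlift (fun a b => a * qbeta * antipode b) (comul qbialg h)
      = counit qbialg h *: qbeta;
  antipode_assoc :
    tlift3 (fun x y z => x * qbeta * antipode y * qalpha * z) (assoc qbialg)
      = 1;
  antipode_assocV :
    tlift3 (fun x y z => antipode x * qalpha * y * qbeta * antipode z)
      (assoc qbialg)^-1 = 1
}.

Section Twist.
Variables (k : fieldType) (H : falgType k) (Q : quasiHopf H).
Variables (u : H) (Uu : u \is a GRing.unit).

Definition antipode_conj (h : H) : H := u * antipode Q h * u^-1.

Lemma antipode_conj_linear : linear antipode_conj.
Proof.
move=> a x y; rewrite /antipode_conj linearP mulrDr mulrDl.
by rewrite -scalerAr -scalerAl.
Qed.

HB.instance Definition _ :=
  GRing.isLinear.Build k H H _ antipode_conj antipode_conj_linear.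

Lemma antipode_conj_bij : bijective antipode_conj.
Proof.
have [g gK Kg] := antipode_bij Q.
exists (fun h => g (u^-1 * h * u)) => h; rewrite /antipode_conj.
  by rewrite !mulrA mulVr // mul1r mulrVK.
by rewrite Kg !mulrA mulrV // mul1r mulrK.
Qed.

Lemma antipode_conj1 : antipode_conj 1 = 1.
Proof. by rewrite /antipode_conj antipode1 mulr1 divrr. Qed.

Lemma antipode_conjM a b :
  antipode_conj (a * b) = antipode_conj b * antipode_conj a.
Proof. by rewrite /antipode_conj antipodeM !mulrA mulrVK. Qed.

Lemma antipode_conj_alpha h :
  tlift (fun a b => antipode_conj a * (u * qalpha Q) * b) (comul Q h)
    = counit Q h *: (u * qalpha Q).
Proof.
rewrite scalerAr -antipode_alpha.
apply: etrans (tlift_comp (u \*o idfun) _ _).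
by apply: eq_tlift => a b; rewrite /antipode_conj /= !mulrA mulrVK.
Qed.

Lemma antipode_conj_beta h :
  tlift (fun a b => a * (qbeta Q * u^-1) * antipode_conj b) (comul Q h)
    = counit Q h *: (qbeta Q * u^-1).
Proof.
rewrite scalerAl -antipode_beta.
apply: etrans (tlift_comp (u^-1 \o* idfun) _ _).
by apply: eq_tlift => a b; rewrite /antipode_conj /= !mulrA mulrVK.
Qed.

Lemma antipode_conj_assoc :
  tlift3 (fun x y z => x * (qbeta Q * u^-1) * antipode_conj y
                         * (u * qalpha Q) * z) (assoc Q) = 1.
Proof.
rewrite -(antipode_assoc Q); apply: eq_tlift => x; apply: eq_tlift => y z.
by rewrite /antipode_conj !mulrA !mulrVK.
Qed.

Lemma antipode_conj_assocV :
  tlift3 (fun x y z => antipode_conj x * (u * qalpha Q) * y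
                         * (qbeta Q * u^-1) * antipode_conj z) (assoc Q)^-1 = 1.
Proof.
transitivity (antipode_conj 1); last exact: antipode_conj1.
rewrite /antipode_conj antipode1 -(antipode_assocV Q).
apply: etrans (tlift_comp ((u^-1 \o* idfun) \o (u \*o idfun)) _ _).
apply: eq_tlift => x t.
apply: etrans (tlift_comp ((u^-1 \o* idfun) \o (u \*o idfun)) _ _).
by apply: eq_tlift => y z; rewrite /antipode_conj /= !mulrA !mulrVK.
Qed.

(* The quasi-Hopf algebra H_u *)
Definition quasiHopf_twist : quasiHopf H :=
  @QuasiHopf k H Q (u * qalpha Q) (qbeta Q * u^-1) antipode_conj
    antipode_conj_bij antipode_conj1 antipode_conjM antipode_conj_alpha
    antipode_conj_beta antipode_conj_assoc antipode_conj_assocV.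

End Twist.

(* h |-> (pi_i h)_i is an isomorphism of H onto the direct sum of the         *)
(* 'M[k]_((n i).+1), whose operations are componentwise.                        *)
Definition split_semisimple (k : fieldType) (H : falgType k) : Prop :=
  exists (r : nat) (n : 'I_r -> nat)
         (pi : forall i, {lrmorphism H -> 'M[k]_((n i).+1)}),
    bijective (fun h => [ffun i => pi i h]
                 : {dffun forall i : 'I_r, 'M[k]_((n i).+1)}).

(* Main.v *)
Require Import Defs.
From HB Require Import structures.
From mathcomp Require Import all_boot all_algebra all_field.
Import GRing.Theory.
Local Open Scope ring_scope.

(* The main point is that S^2 fixes the centre. Let e be an integral with
   eps(e) = 1 and put cap(s) = A(Delta(e) s), where A(a (x) b) = a beta S(b).
   Then cap is invariant, cap(Delta(h) s) = eps(h) cap(s), and cap(1) = beta.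
   This is a map V (x) V^* -> 1 that does not vanish, and rigidity turns it
   into a map V -> V^**: quasi-coassociativity makes z (x) 1 and 1 (x) S(z)
   interchangeable in cap(pR _ s) for the element pR of Hausser and Nill, so
   that cap(pR s) c = 0 for z central and c = z - S^2(z), and the pentagon
   recovers cap from s |-> cap(pR s). Hence beta c = 0, and c = 0 follows from
   sum X beta S(Y) alpha Z = 1. So S permutes the matrix blocks by an
   involution s, and u is chosen blockwise by Skolem-Noether: where s i = i,
   u_i turns S into transposition, and for each pair {i, s i} one u_i is 1 and
   the other undoes S^2. *)

Definition central (R : pzRingType) (z : R) := forall x, z * x = x * z.
Arguments central {R} z.

(** * Tensor products of linear maps and of algebra maps *)

Section TensorMaps.
Variable k : fieldType.

Lemma tmap_linear (U U' V V' : vectType k) (f : U -> U') (g : V -> V') :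
  linear (tmap f g).
Proof. exact: tlift_linear. Qed.
HB.instance Definition _ (U U' V V' : vectType k) f g :=
  GRing.isLinear.Build k (tens U V) (tens U' V') _ (tmap f g)
    (@tmap_linear U U' V V' f g).

Lemma tassoc_linear (U V W : vectType k) : linear (@tassoc k U V W).
Proof. exact: tlift_linear. Qed.
HB.instance Definition _ (U V W : vectType k) :=
  GRing.isLinear.Build k _ _ _ (@tassoc k U V W) (@tassoc_linear U V W).

Lemma tpure_linear_r (U V : vectType k) (u : U) : linear (@tpure k U V u).
Proof. by move=> a x y; rewrite tpureDr tpureZr. Qed.
HB.instance Definition _ (U V : vectType k) u :=
  GRing.isLinear.Build k V (tens U V) _ (tpure u) (@tpure_linear_r U V u).

Lemma tpure0l (U V : vectType k) (v : V) : tpure (0 : U) v = 0.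
Proof. by rewrite -[0 in LHS](scale0r 0) tpureZl scale0r. Qed.

Lemma tmapM (A A' B B' : falgType k) (f : {lrmorphism A -> A'})
    (g : {lrmorphism B -> B'}) :
  {morph tmap f g : s t / s * t}.
Proof.
move=> s t; elim/tens_ind: s => [|s s' IHs IHs'|a b].
- by rewrite !(mul0r, linear0).
- by rewrite !(mulrDl, linearD) /= IHs IHs'.
elim/tens_ind: t => [|t t' IHt IHt'|c d].
- by rewrite !(mulr0, linear0).
- by rewrite !(mulrDr, linearD) /= IHt IHt'.
by rewrite tpureM !tmapE tpureM !rmorphM.
Qed.

Lemma tmap1 (A A' B B' : falgType k) (f : {lrmorphism A -> A'})
    (g : {lrmorphism B -> B'}) :
  tmap f g 1 = 1.
Proof. by rewrite -[1 in LHS]tpure1 tmapE !rmorph1. Qed.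

HB.instance Definition _ (A A' B B' : falgType k) (f : {lrmorphism A -> A'})
    (g : {lrmorphism B -> B'}) :=
  GRing.isMonoidMorphism.Build (tens A B) (tens A' B') (tmap f g)
    (conj (@tmap1 A A' B B' f g) (@tmapM A A' B B' f g)).

Lemma tassocM (A B C : falgType k) : {morph @tassoc k A B C : s t / s * t}.
Proof.
move=> s t; elim/tens_ind: s => [|s s' IHs IHs'|ab c].
- by rewrite !(mul0r, linear0).
- by rewrite !(mulrDl, linearD) /= IHs IHs'.
elim/tens_ind: t => [|t t' IHt IHt'|ab' c'].
- by rewrite !(mulr0, linear0).
- by rewrite !(mulrDr, linearD) /= IHt IHt'.
elim/tens_ind: ab => [|s s' IHs IHs'|a b].
- by rewrite !(tpure0l, mul0r, linear0).
- by rewrite tpureDl !(mulrDl, linearD) /= IHs IHs'.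
elim/tens_ind: ab' => [|s s' IHs IHs'|a' b'].
- by rewrite !(tpure0l, mulr0, linear0).
- by rewrite tpureDl !(mulrDr, linearD) /= IHs IHs'.
by rewrite !(tpureM, tassocE).
Qed.

Lemma tassoc1 (A B C : falgType k) : @tassoc k A B C 1 = 1.
Proof. by rewrite -[1 in LHS]tpure1 -tpure1 tassocE. Qed.

HB.instance Definition _ (A B C : falgType k) :=
  GRing.isMonoidMorphism.Build _ _ (@tassoc k A B C)
    (conj (@tassoc1 A B C) (@tassocM A B C)).

End TensorMaps.

(** * Contractions of tensors by the antipode and the counit *)

Section QuasiHopf.
Variables (k : fieldType) (H : falgType k) (Q : quasiHopf H).
Local Notation S := (antipode Q).
Local Notation eps := (counit Q).
Local Notation D := (comul Q).
Local Notation alpha := (qalpha Q).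
Local Notation beta := (qbeta Q).
Local Notation Phi := (assoc Q).

(** The map A of the overview. *)
Definition sbeta : tens H H -> H := tlift (fun a b => a * beta * S b).
HB.instance Definition _ := GRing.Linear.on sbeta.

Definition sbetalpha : tens H (tens H H) -> H :=
  tlift3 (fun x y z => x * beta * S y * alpha * z).
HB.instance Definition _ := GRing.Linear.copy sbetalpha (tlift _).

Definition counitr : tens H H -> H := tlift (fun a b => eps b *: a).
HB.instance Definition _ := GRing.Linear.copy counitr (tlift _).
Definition counitl : tens H H -> H := tlift (fun a b => eps a *: b).
HB.instance Definition _ := GRing.Linear.copy counitl (tlift _).

Lemma sbetaE a b : sbeta (tpure a b) = a * beta * S b.
Proof.
apply: tliftE; split=> [v c x y|u c x y].
  by rewrite !mulrDl -!scalerAl.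
by rewrite linearP mulrDr -scalerAr.
Qed.

Lemma counitrE a b : counitr (tpure a b) = eps b *: a.
Proof.
apply: tliftE; split=> [v c x y|u c x y].
  by rewrite scalerDr !scalerA mulrC.
by rewrite linearP scalerDl scalerA.
Qed.

Lemma counitlE a b : counitl (tpure a b) = eps a *: b.
Proof.
apply: tliftE; split=> [v c x y|u c x y].
  by rewrite linearP scalerDl scalerA.
by rewrite scalerDr !scalerA mulrC.
Qed.

Lemma sbetalphaE x y z :
  sbetalpha (tpure x (tpure y z)) = x * beta * S y * alpha * z.
Proof.
have E x' : tlift (fun y z => x' * beta * S y * alpha * z) (tpure y z)
    = x' * beta * S y * alpha * z.
  apply: tliftE; split=> [v c x1 y1|u c x1 y1].
    by rewrite linearP mulrDr !mulrDl -scalerAr -!scalerAl.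
  by rewrite mulrDr -scalerAr.
rewrite /sbetalpha /tlift3 tliftE ?E //; split=> [w a u v|u a s t].
  rewrite -[_ *: _]/(GRing.scale a _) -(tlift_comp (GRing.scale a)) -tliftD.
  by apply: eq_tlift => u' v'; rewrite /= !mulrDl -!scalerAl.
exact: linearP.
Qed.

Definition salpha : tens H H -> H := tlift (fun a b => S a * alpha * b).
HB.instance Definition _ := GRing.Linear.copy salpha (tlift _).

Lemma salphaE a b : salpha (tpure a b) = S a * alpha * b.
Proof.
apply: tliftE; split=> [v c x y|u c x y].
  by rewrite linearP !mulrDl -!scalerAl.
by rewrite mulrDr -scalerAr.
Qed.

(** Multiplicativity turns [tmap idfun counitr] into a ring morphism, so that its value at [Phi^-1]
    is invertible. *)
Lemma counitrM : {morph counitr : s t / s * t}.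
Proof.
move=> s t; elim/tens_ind: s => [|s s' IHs IHs'|a b].
- by rewrite !(mul0r, linear0).
- by rewrite !(mulrDl, linearD) /= IHs IHs'.
elim/tens_ind: t => [|t t' IHt IHt'|c d].
- by rewrite !(mulr0, linear0).
- by rewrite !(mulrDr, linearD) /= IHt IHt'.
by rewrite tpureM !counitrE rmorphM -scalerAl -scalerAr scalerA.
Qed.

Lemma counitr1 : counitr 1 = 1.
Proof. by rewrite -[1 in LHS]tpure1 counitrE rmorph1 scale1r. Qed.

HB.instance Definition _ :=
  GRing.isMonoidMorphism.Build (tens H H) H counitr (conj counitr1 counitrM).

Lemma sbeta_pureM a b s : sbeta (tpure a b * s) = a * sbeta s * S b.
Proof.
elim/tens_ind: s => [|s s' IHs IHs'|c d].
- by rewrite mulr0 !linear0 mulr0 mul0r.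
- by rewrite mulrDr !linearD /= mulrDr mulrDl IHs IHs'.
by rewrite tpureM !sbetaE antipodeM !mulrA.
Qed.

Lemma sbeta_comul h : sbeta (D h) = eps h *: beta.
Proof. exact: antipode_beta. Qed.

Lemma sbeta_mul_comul s h : sbeta (s * D h) = eps h *: sbeta s.
Proof.
elim/tens_ind: s => [|s s' IHs IHs'|c d].
- by rewrite mul0r !linear0.
- by rewrite mulrDl !linearD /= IHs IHs'.
by rewrite sbeta_pureM sbeta_comul sbetaE -scalerAr -scalerAl.
Qed.

(** For [w] = h (x) g the factor Delta(g) ends up around beta and collapses to eps(g), so only h
    survives, in the first leg. *)
Lemma tmap_sbeta_comulr Psi w :
  tmap idfun sbeta (Psi * tmap idfun D w)
    = tmap idfun sbeta Psi * tpure (counitr w) 1.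
Proof.
elim/tens_ind: w => [|s s' IHs IHs'|h g].
- by rewrite !linear0 mulr0 linear0 tpure0l mulr0.
- by rewrite !linearD /= !mulrDr linearD /= IHs IHs' tpureDl mulrDr.
elim/tens_ind: Psi => [|s s' IHs IHs'|a t].
- by rewrite !(linear0, mul0r).
- by rewrite !(linearD, mulrDl) /= IHs IHs'.
rewrite !tmapE tpureM !tmapE /= tpureM mulr1 sbeta_mul_comul counitrE.
by rewrite tpureZr -scalerAr tpureZl.
Qed.

(** Since S reverses products, a left factor b of the last leg comes out on the right as S(b). *)
Lemma tmap_sbeta_tassoc v b Psi :
  tmap idfun sbeta ((tassoc (tpure v b) : tens H (tens H H)) * Psi)
    = v * tmap idfun sbeta Psi * tpure 1 (S b).
Proof.
elim/tens_ind: v => [|s s' IHs IHs'|x y].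
- by rewrite tpure0l linear0 !mul0r linear0.
- by rewrite tpureDl linearD /= !mulrDl linearD /= IHs IHs'.
elim/tens_ind: Psi => [|s s' IHs IHs'|c t].
- by rewrite !(linear0, mulr0, mul0r).
- by rewrite !(linearD, mulrDr, mulrDl) /= IHs IHs'.
by rewrite tassocE tpureM !tmapE !tpureM /= sbeta_pureM mulr1.
Qed.

(** S(z_1 c) alpha z_2 = S(c) S(z_1) alpha z_2 = eps(z) S(c) alpha, so alpha absorbs a coproduct
    multiplying the last two legs from the left. *)
Lemma tmap_sbetalpha_comulr (t : tens H (tens H H))
    (w : tens H (tens H (tens H H))) :
  tmap idfun sbetalpha
      ((tmap idfun (tmap idfun D) t : tens H (tens H (tens H H))) * w)
    = tmap idfun counitr t * tmap idfun sbetalpha w.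
Proof.
elim/tens_ind: t => [|s s' IHs IHs'|x t].
- by rewrite !(linear0, mul0r).
- by rewrite !(linearD, mulrDl) /= IHs IHs'.
elim/tens_ind: w => [|s s' IHs IHs'|a w].
- by rewrite !(linear0, mulr0).
- by rewrite !(linearD, mulrDr) /= IHs IHs'.
rewrite !tmapE [X in tmap _ _ X](@tpureM k H (tens H (tens H H))).
rewrite tmapE tpureM /=; congr tpure.
elim/tens_ind: t => [|s s' IHs IHs'|y z].
- by rewrite !(linear0, mul0r).
- by rewrite !(linearD, mulrDl) /= IHs IHs'.
elim/tens_ind: w => [|s s' IHs IHs'|b w].
- by rewrite !(linear0, mulr0).
- by rewrite !(linearD, mulrDr) /= IHs IHs'.
rewrite !tmapE [X in sbetalpha X](@tpureM k H (tens H H)) counitrE /=.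
elim/tens_ind: w => [|s s' IHs IHs'|c d].
- by rewrite !(linear0, mulr0).
- by rewrite !(linearD, mulrDr) /= IHs IHs'.
suff E v : sbetalpha (tpure (y * b) (v * tpure c d))
    = y * b * beta * S c * salpha v * d.
  apply: etrans (E (D z)) _; rewrite [salpha _]antipode_alpha sbetalphaE.
  by rewrite -!(scalerAl, scalerAr) !mulrA.
elim/tens_ind: v => [|s s' IHs IHs'|p q].
- by rewrite !(mul0r, linear0, mulr0).
- by rewrite !(linearD, mulrDl, mulrDr) /= IHs IHs'.
by rewrite tpureM sbetalphaE salphaE antipodeM !mulrA.
Qed.

(** b y_1 beta S(c y_2) = eps(y) b beta S(c), so beta absorbs a coproduct multiplying the two middle
    legs from the right. *)
Lemma tmap_sbetalpha_comulm (t : tens H (tens H H))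
    (w : tens H (tens H (tens H H))) :
  tmap idfun sbetalpha (w * tmap idfun (@tassoc k H H H \o tmap D idfun) t)
    = tmap idfun sbetalpha w * tmap idfun counitl t.
Proof.
elim/tens_ind: t => [|s s' IHs IHs'|x t].
- by rewrite !(linear0, mulr0).
- by rewrite !(linearD, mulrDr) /= IHs IHs'.
elim/tens_ind: w => [|s s' IHs IHs'|a w].
- by rewrite !(linear0, mul0r).
- by rewrite !(linearD, mulrDl) /= IHs IHs'.
rewrite !tmapE [X in tmap _ _ X](@tpureM k H (tens H (tens H H))).
rewrite tmapE tpureM /=; congr tpure.
elim/tens_ind: t => [|s s' IHs IHs'|y z].
- by rewrite !(linear0, mulr0).
- by rewrite !(linearD, mulrDr) /= IHs IHs'.
elim/tens_ind: w => [|s s' IHs IHs'|b w].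
- by rewrite !(linear0, mul0r).
- by rewrite !(linearD, mulrDl) /= IHs IHs'.
rewrite !tmapE counitlE /=.
elim/tens_ind: w => [|s s' IHs IHs'|c d].
- by rewrite !(linear0, mul0r).
- by rewrite !(linearD, mulrDl) /= IHs IHs'.
suff E v : sbetalpha (tpure b (tpure c d)
                     * (tassoc (tpure v z) : tens H (tens H H)))
    = b * sbeta v * S c * alpha * d * z.
  apply: etrans (E (D y)) _; rewrite sbeta_comul sbetalphaE.
  by rewrite -!(scalerAl, scalerAr).
elim/tens_ind: v => [|s s' IHs IHs'|p q].
- by rewrite !(tpure0l, linear0, mulr0, mul0r).
- by rewrite tpureDl !(linearD, mulrDr, mulrDl) /= IHs IHs'.
by rewrite tassocE !tpureM sbetalphaE sbetaE antipodeM !mulrA.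
Qed.

(** The contraction splits, because y p beta S(m q) alpha n = (y p beta S(q)) (S(m) alpha n). *)
Lemma tmap_sbetalpha_tassoc (v t : tens H H) (Psi : tens H (tens H H)) :
  tmap idfun sbetalpha
      ((tassoc (tpure v t) : tens H (tens H (tens H H)))
       * tmap idfun (@tassoc k H H H) (tassoc (tpure Psi 1)))
    = v * tmap idfun sbeta Psi * tpure 1 (salpha t).
Proof.
elim/tens_ind: v => [|s s' IHs IHs'|x y].
- by rewrite tpure0l linear0 !mul0r linear0.
- by rewrite tpureDl linearD /= !mulrDl linearD /= IHs IHs'.
elim/tens_ind: Psi => [|s s' IHs IHs'|c w].
- by rewrite !(tpure0l, linear0, mulr0, mul0r).
- by rewrite tpureDl !(linearD, mulrDr, mulrDl) /= IHs IHs'.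
rewrite !tassocE !tmapE [X in tmap _ _ X](@tpureM k H (tens H (tens H H))).
rewrite tmapE !tpureM /= mulr1; congr tpure.
elim/tens_ind: w => [|s s' IHs IHs'|p q].
- by rewrite !(tpure0l, linear0, mulr0, mul0r).
- by rewrite tpureDl !(linearD, mulrDr, mulrDl) /= IHs IHs'.
elim/tens_ind: t => [|s s' IHs IHs'|m n].
- by rewrite !(tpure0l, linear0, mulr0, mul0r).
- by rewrite !(linearD, mulrDl, mulrDr) /= IHs IHs'.
by rewrite tassocE !tpureM sbetalphaE sbetaE salphaE antipodeM !mulrA mulr1.
Qed.

Lemma antipode_central z : central z -> central (S z).
Proof.
have [g gK Kg] := antipode_bij Q.
by move=> zC x; rewrite -(Kg x) -!antipodeM zC.
Qed.

Lemma tpure_central (a b : H) :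
  central a -> central b -> central (tpure a b : tens H H).
Proof.
move=> aC bC s; elim/tens_ind: s => [|s s' IHs IHs'|c d].
- by rewrite mul0r mulr0.
- by rewrite mulrDr mulrDl IHs IHs'.
by rewrite !tpureM aC bC.
Qed.

Lemma sbeta_centrall z (s : tens H H) :
  central z -> sbeta (s * tpure z 1) = sbeta s * z.
Proof.
move=> zC; elim/tens_ind: s => [|s s' IHs IHs'|a b].
- by rewrite mul0r !linear0 mul0r.
- by rewrite mulrDl !linearD mulrDl /= IHs IHs'.
by rewrite tpureM !sbetaE mulr1 -!mulrA; congr (_ * _); rewrite zC -mulrA.
Qed.

(** The square of the antipode enters here: S(b S(z)) = S(S(z)) S(b), and S(S(z)) is again
    central. *)
Lemma sbeta_centralr z (s : tens H H) :
  central z -> sbeta (s * tpure 1 (S z)) = sbeta s * S (S z).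
Proof.
move=> zC; elim/tens_ind: s => [|s s' IHs IHs'|a b].
- by rewrite mul0r !linear0 mul0r.
- by rewrite mulrDl !linearD mulrDl /= IHs IHs'.
rewrite tpureM !sbetaE mulr1 antipodeM -!mulrA; congr (_ * (_ * _)).
by do 2!apply: antipode_central.
Qed.

(** * The square of the antipode on the centre, by means of a right integral *)

Variable e : H.
Hypothesis eI : forall h, e * h = eps h *: e.

Definition cap s := sbeta (D e * s).
Lemma cap_linear : linear cap.
Proof. by move=> a s t; rewrite /cap mulrDr -scalerAr linearP. Qed.
HB.instance Definition _ :=
  GRing.isLinear.Build k (tens H H) H _ cap cap_linear.

Lemma cap_comul h s : cap (D h * s) = eps h *: cap s.
Proof.
have DM : D e * D h = eps h *: D e by rewrite -rmorphM eI; exact: linearZZ.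
by rewrite /cap mulrA DM -scalerAl linearZ.
Qed.

Definition pR := tmap idfun sbeta Phi^-1.

(** For [w] = a (x) b the contraction is Delta(a) pR (1 (x) S(b)), and [cap] turns Delta(a) into
    eps(a). An arbitrary [w] replaces Delta(h) so that pure tensors suffice. *)
Lemma cap_adjoint_tens w s :
  cap (tmap idfun sbeta (tassoc (tmap D idfun w) * Phi^-1) * s)
    = cap (pR * tpure 1 (S (counitl w)) * s).
Proof.
elim/tens_ind: w => [|w w' IHs IHs'|a b].
- by rewrite !(linear0, mul0r, mulr0).
- by rewrite !(linearD, mulrDl, mulrDr) /= IHs IHs'.
rewrite tmapE tmap_sbeta_tassoc -!mulrA cap_comul counitlE linearZ /= linearZ.
by rewrite -scalerAl -scalerAr linearZ.
Qed.

(** Quasi-coassociativity gives (Delta (x) 1)Delta(h) Phi^-1 = Phi^-1 (1 (x) Delta)Delta(h).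
    Contracted, the left side yields S(h) in the second leg and the right side h in the first. *)
Lemma cap_adjoint h s : cap (pR * tpure h 1 * s) = cap (pR * tpure 1 (S h) * s).
Proof.
have := cap_adjoint_tens (D h) s; rewrite [counitl _]counit_comul => <-.
have -> : tassoc (tmap D idfun (D h)) * Phi^-1
    = Phi^-1 * tmap idfun D (D h).
  by rewrite -quasi_coassoc !mulrA mulVr ?mul1r // assoc_unit.
by rewrite tmap_sbeta_comulr [counitr _]comul_counit.
Qed.

(** Both z (x) 1 and 1 (x) S(z) are central, so they slide past [s] to the right end, where [sbeta]
    turns them into z and S(S(z)). *)
Lemma antipode_sqr_cap z s : central z -> cap (pR * s) * (z - S (S z)) = 0.
Proof.
move=> zC; apply/eqP; rewrite mulrBr subr_eq0; apply/eqP.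
rewrite -[in LHS]sbeta_centrall // -sbeta_centralr // -!mulrA.
have oneC : central (1 : H) by move=> x; rewrite mul1r mulr1.
have SzC := antipode_central z zC.
rewrite -(tpure_central _ _ zC oneC) -(tpure_central _ _ oneC SzC).
by have := cap_adjoint z s; rewrite /cap !mulrA.
Qed.

(** This removes [pR] at the cost of an invertible factor in front of [s]. *)
Lemma cap_pentagon c :
  (forall s, cap (pR * s) * c = 0) ->
  forall s, cap (tmap idfun counitr Phi^-1 * s) * c = 0.
Proof.
move=> pc s.
(* Both sides of the pentagon, rearranged as (Delta (x) 1 (x) 1)(Phi) (Phi^-1
   (x) 1) = (1 (x) 1 (x) Delta)(Phi^-1) (1 (x) Phi) (1 (x) Delta (x) 1)(Phi),
   are evaluated by a (x) b (x) c (x) d |-> a (x) b beta S(c) alpha d. *)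
have [VPhi PhiV] := (mulVr (assoc_unit Q), divrr (assoc_unit Q)).
pose R (t : tens H (tens H H)) : tens H (tens H (tens H H)) :=
  tmap idfun (@tassoc k H H H) (tassoc (tpure t 1)).
pose N : tens H (tens H (tens H H)) :=
  tassoc (tmap D idfun Phi) * R Phi^-1.
have NE : tmap idfun sbetalpha N = tmap idfun counitr Phi^-1.
  have -> : N = (tmap idfun (tmap idfun D) Phi^-1 : tens H (tens H (tens H H)))
      * (tpure 1 Phi * tmap idfun (@tassoc k H H H \o tmap D idfun) Phi).
    have := pentagon Q; rewrite -/(R Phi) => pent.
    have RV : R Phi * R Phi^-1 = 1.
      by rewrite /R -tmapM -tassocM tpureM PhiV mulr1 tpure1 tassoc1 tmap1.
    have PV : (tmap idfun (tmap idfun D) Phi^-1 : tens H (tens H (tens H H)))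
       * tmap idfun (tmap idfun D) Phi = 1.
      by rewrite -tmapM VPhi tmap1.
    rewrite -[RHS]mulr1 -RV -!mulrA [X in _ * X]mulrA [X in _ * X]mulrA -pent.
    by rewrite !mulrA PV mul1r.
  (* The last factor becomes 1 by [assoc_counit], the middle one by [antipode_assoc]. *)
  rewrite tmap_sbetalpha_comulr tmap_sbetalpha_comulm assoc_counit.
  by rewrite tmapE /= (antipode_assoc Q : sbetalpha Phi = 1) tpure1 !mulr1.
rewrite -NE.
(* For a pure tensor x (x) t the contraction is Delta(x) pR (1 (x) salpha(t)). Here [cap] reduces
   Delta(x) to a scalar and [c] kills the rest. *)
suff gen t : cap (tmap idfun sbetalpha
    ((tassoc (tmap D idfun t) : tens H (tens H (tens H H))) * R Phi^-1) * s)
      * c = 0.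
  exact: gen.
elim/tens_ind: t => [|t t' IHt IHt'|x t].
- by rewrite !linear0 !(mul0r, linear0).
- rewrite !linearD /= !mulrDl !linearD /= !mulrDl linearD /= mulrDl.
  by rewrite IHt IHt' addr0.
by rewrite tmapE tmap_sbetalpha_tassoc -!mulrA cap_comul -scalerAl pc scaler0.
Qed.

(** A central [c] slides left until it meets beta. *)
Lemma sbetalpha_eq0 c :
  central c -> beta * c = 0 -> forall t, sbetalpha t * c = 0.
Proof.
move=> cC bc t; elim/tens_ind: t => [|t t' IHt IHt'|x w].
- by rewrite linear0 mul0r.
- by rewrite linearD mulrDl /= IHt IHt' addr0.
elim/tens_ind: w => [|t t' IHt IHt'|y z].
- by rewrite !linear0 mul0r.
- by rewrite !linearD mulrDl /= IHt IHt' addr0.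
rewrite sbetalphaE -!mulrA -[z * c]cC ![_ * (c * _)]mulrA.
rewrite -[alpha * c]cC -mulrA ![_ * (c * _)]mulrA -[S y * c]cC.
by rewrite -!mulrA [beta * _]mulrA bc !(mul0r, mulr0).
Qed.

Lemma antipode_sqr_central z : eps e = 1 -> central z -> S (S z) = z.
Proof.
move=> e1 zC; apply/eqP; rewrite eq_sym -subr_eq0.
set c := z - S (S z).
have cC : central c.
  move=> x; rewrite mulrBl mulrBr zC; congr (_ - _).
  by do 2!apply: antipode_central.
(* Multiplying [s] by the image of [Phi] cancels the factor from [cap_pentagon]. *)
have capc s : cap s * c = 0.
  have := cap_pentagon _ (fun s => antipode_sqr_cap z s zC)
    (tmap idfun counitr Phi * s).
  by rewrite mulrA -tmapM mulVr ?assoc_unit // tmap1 mul1r.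
(* The normalisation of the integral gives cap(1) = eps(e) beta = beta. *)
have bc : beta * c = 0.
  by have := capc 1; rewrite /cap mulr1 sbeta_comul e1 scale1r.
have := sbetalpha_eq0 c cC bc Phi.
by rewrite (antipode_assoc Q : sbetalpha Phi = 1) mul1r => ->.
Qed.

End QuasiHopf.

(** * Endomorphisms and primeness of matrix algebras *)

(* Skolem-Noether: psi intertwines the standard row module with its twist by
   phi, and P is the matrix of psi. *)
Lemma matrix_endomorphism_inner (k : fieldType) (n : nat)
    (phi : {linear 'M[k]_n.+1 -> 'M[k]_n.+1}) :
  phi 1 = 1 -> {morph phi : x y / x * y} ->
  exists2 P, P \is a GRing.unit & forall x, P * phi x * P^-1 = x.
Proof.
move=> phi1 phiM.
(* Otherwise [phi] kills every E_ii = E_i0 E_00 E_0i, hence also their sum 1. *)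
have phi00 : phi (delta_mx 0 0) != 0.
  apply/eqP => p0; have /eqP[] := oner_neq0 'M[k]_n.+1.
  rewrite -phi1 -[1]/(1%:M) mx1_sum_delta linear_sum big1 // => i _.
  have -> : delta_mx i i = delta_mx i 0 * (delta_mx 0 0 * delta_mx 0 i)
      :> 'M[k]_n.+1.
    by rewrite -!mulmxE !mul_delta_mx.
  by rewrite !phiM p0 mul0r mulr0.
have [i ri] : exists i, row i (phi (delta_mx 0 0)) != 0.
  apply/existsP; apply: contraR phi00; rewrite negb_exists => /forallP r0.
  by apply/eqP/row_matrixP=> i; rewrite row0; apply/eqP/negbNE/r0.
pose psi (x : 'rV[k]_n.+1) :=
  delta_mx 0 i *m phi (delta_mx (0 : 'I_n.+1) (0 : 'I_1) *m x) : 'rV_n.+1.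
have psi_lin : linear psi.
  by move=> a x y; rewrite /psi mulmxDr -scalemxAr linearP mulmxDr -scalemxAr.
pose psiL : {linear 'rV[k]_n.+1 -> 'rV[k]_n.+1} :=
  HB.pack psi (GRing.isLinear.Build k _ _ _ psi psi_lin).
have psiA x A : psi x *m phi A = psi (x *m A).
  by rewrite /psi -mulmxA [_ *m phi A](esym (phiM _ _)) -[_ * A]mulmxA.
pose P := lin1_mx psiL.
have PE x : x *m P = psi x by rewrite /P mul_rV_lin1.
have PP A : P *m phi A = A *m P.
  by apply/row_matrixP=> j; rewrite !rowE !mulmxA !PE psiA.
(* If psi(x) = 0 with x_j nonzero, then e_0 = x A for A = x_j^-1 E_j0, so psi(e_0) = psi(x) phi(A) =
   0. But psi(e_0) is the nonzero row i of phi(E_00). *)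
have Pu : P \in unitmx.
  rewrite -row_free_unit -kermx_eq0; apply/rowV0P=> x /sub_kermxP.
  rewrite PE => x0; apply/eqP; apply: contraR ri => /rV0Pn[j xj].
  have e0 : delta_mx 0 0 = x *m ((x 0 j)^-1 *: delta_mx j 0) :> 'rV[k]_n.+1.
    rewrite -[delta_mx j 0](mul_delta_mx (0 : 'I_1)) -scalemxAr mulmxA -colE.
    by rewrite [col j x]mx11_scalar mxE mul_scalar_mx scalerA mulVf ?scale1r.
  rewrite rowE -[X in phi X](mul_delta_mx (0 : 'I_1)).
  by rewrite -[_ *m _]/(psi (delta_mx 0 0)) e0 -psiA x0 mul0mx.
by exists P => // x; rewrite -[P * _]/(P *m _) PP -[_ *m P]/(x * P) mulrK.
Qed.

(** The (i, j') entry of a E_ji' b is a_ij b_i'j'. *)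
Lemma matrix_prime (k : fieldType) (n : nat) (a b : 'M[k]_n.+1) :
  (forall x, a * x * b = 0) -> a = 0 \/ b = 0.
Proof.
move=> ab; have [->|/matrix0Pn[i [j aij]]] := eqVneq a 0; first by left.
have [->|/matrix0Pn[i' [j' bij]]] := eqVneq b 0; first by right.
have /matrixP/(_ i j') := ab (delta_mx j i').
rewrite -(mul_delta_mx (0 : 'I_1)) -!mulmxE mulmxA -mulmxA -colE -rowE.
rewrite !mxE big_ord1 !mxE => /eqP.
by rewrite mulf_eq0 (negPf aij) (negPf bij).
Qed.

(** * The matrix blocks of a split semi-simple algebra *)

Section Blocks.
Variables (k : fieldType) (H : falgType k) (r : nat) (n : 'I_r -> nat).
Variable pi : forall i, {lrmorphism H -> 'M[k]_((n i).+1)}.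
Let pis h : {dffun forall i : 'I_r, 'M[k]_((n i).+1)} := [ffun i => pi i h].
Variable g : {dffun forall i : 'I_r, 'M[k]_((n i).+1)} -> H.
Hypotheses (gK : cancel pis g) (Kg : cancel g pis).

Definition glue (f : forall i, 'M[k]_((n i).+1)) : H := g [ffun i => f i].

Lemma pi_glue f i : pi i (glue f) = f i.
Proof. by have /ffunP/(_ i) := Kg [ffun i => f i]; rewrite !ffunE. Qed.

Lemma pi_inj x y : (forall i, pi i x = pi i y) -> x = y.
Proof.
by move=> xy; apply: (can_inj gK); apply/ffunP=> i; rewrite !ffunE xy.
Qed.

(** The embedding of the block as an ideal; [block i 1] is its central idempotent. *)
Definition block i (a : 'M[k]_((n i).+1)) : H :=
  glue (@dfwith _ _ (fun j => 0 : 'M[k]_((n j).+1)) i a).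

Lemma piM i x y : pi i (x * y) = pi i x * pi i y :> 'M[k]_((n i).+1).
Proof. exact: rmorphM. Qed.

Lemma pi_block i a : pi i (block i a) = a.
Proof. by rewrite pi_glue dfwith_in. Qed.

Lemma pi_block_neq i j a : i != j -> pi j (block i a) = 0.
Proof. by move=> ij; rewrite pi_glue dfwith_out. Qed.

Lemma block_linear i : linear (block i).
Proof.
move=> c a b; apply: pi_inj => j; rewrite linearP.
have [<-|ij] := eqVneq i j; first by rewrite /= !pi_block.
by rewrite /= !pi_block_neq // scaler0 addr0.
Qed.
HB.instance Definition _ i :=
  GRing.isLinear.Build k 'M[k]_((n i).+1) H _ (block i) (block_linear i).

Lemma blockM i (a b : 'M[k]_((n i).+1)) :
  block i (a * b) = block i a * block i b.
Proof.
apply: pi_inj => j; rewrite piM.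
have [<-|ij] := eqVneq i j; first by rewrite !pi_block.
by rewrite !pi_block_neq // mulr0.
Qed.

Lemma block_pi i h : block i (pi i h) = block i 1 * h.
Proof.
apply: pi_inj => j; rewrite piM.
have [<-|ij] := eqVneq i j; first by rewrite !pi_block mul1r.
by rewrite !pi_block_neq // mul0r.
Qed.

Lemma sum_block1 : \sum_i block i 1 = 1.
Proof.
apply: pi_inj => j; rewrite linear_sum (bigD1 j) //= pi_block rmorph1.
by rewrite big1 ?addr0 // => i ij; rewrite pi_block_neq.
Qed.

Lemma block1_central i : central (block i 1).
Proof.
move=> h; apply: pi_inj => j; rewrite !piM.
have [<-|ij] := eqVneq i j; first by rewrite !pi_block mul1r mulr1.
by rewrite !pi_block_neq // mul0r mulr0.
Qed.

Lemma block1_neq0 i : block i 1 != 0.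
Proof.
apply/eqP=> b0; have /eqP[] := oner_neq0 'M[k]_((n i).+1).
by rewrite -[LHS](pi_block i) b0 linear0.
Qed.

(* A one-dimensional representation of a matrix algebra forces size 1, so the
   block on which eps does not vanish is spanned by the integral. *)
Lemma split_integral (eps : {lrmorphism H -> k | *%R}) :
  exists2 e, (forall h, e * h = eps h *: e) & eps e = 1.
Proof.
have [i epsi] : exists i, eps (block i 1) != 0.
  apply/existsP; apply: contraT; rewrite negb_exists => /forallP/= e0.
  have /eqP[] := oner_neq0 k; rewrite -(rmorph1 eps) -sum_block1 rmorph_sum.
  by rewrite big1 // => i _; apply/eqP/negbNE/e0.
have [j epsj] : exists j, eps (block i (delta_mx j j)) != 0.
  apply/existsP; apply: contraR epsi; rewrite negb_exists => /forallP/= e0.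
  rewrite -[1]/(1%:M) mx1_sum_delta !linear_sum.
  by apply/eqP; rewrite big1 // => j _; apply/eqP/negbNE/e0.
set e := block i (delta_mx j j) in epsj.
have ee : eps e = 1.
  by apply: (mulfI epsj); rewrite mulr1 -rmorphM -blockM -mulmxE mul_delta_mx.
(* As k is commutative, eps agrees on E_jl E_lj = E_jj and E_lj E_jl = E_ll. For l different from j,
   E_ll E_jj = 0 would give eps(e)^2 = 0. *)
have j_only l : l = j.
  apply/eqP; apply: contraTT epsj => lj.
  have ell : eps (block i (delta_mx l l)) = eps e.
    transitivity (eps (block i (delta_mx l j) * block i (delta_mx j l))).
      by rewrite -blockM -mulmxE mul_delta_mx.
    by rewrite rmorphM mulrC -rmorphM -blockM -mulmxE mul_delta_mx.
  rewrite negbK -[_ == 0]orbb -mulf_eq0 -{1}ell -rmorphM -blockM -mulmxE.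
  by rewrite mul_delta_mx_0 // linear0 rmorph0.
have eh h : e * h = (pi i h j j) *: e.
  apply: pi_inj => l; rewrite piM linearZ /=.
  have [<-|il] := eqVneq i l; last by rewrite pi_block_neq // mul0r scaler0.
  rewrite !pi_block; apply/matrixP=> a b; rewrite (j_only a) (j_only b).
  rewrite !mxE (bigD1 j) //= !mxE eqxx /= mul1r mulr1 big1 ?addr0 // => m.
  by rewrite (j_only m) eqxx.
have epsZ c x : eps (c *: x) = c * eps x by exact: linearZ.
exists e => // h.
(* Applying eps to [eh] identifies the scalar as eps(h). *)
have : eps e * eps h = pi i h j j * eps e.
  by rewrite -rmorphM eh; exact: epsZ.
by rewrite eh ee mul1r mulr1 => ->.
Qed.

Local Notation e i := (block i 1).

(** f x (1 - f) = 0 for all x, and a matrix algebra is prime. *)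
Lemma central_idempotent f i :
  central f -> f * f = f -> pi i f = 0 \/ pi i f = 1.
Proof.
move=> fC ff; suff [->|/eqP] : pi i f = 0 \/ 1 - pi i f = 0; first by left.
  by rewrite subr_eq0 => /eqP <-; right.
apply: matrix_prime => x; rewrite -(pi_block i x) -piM fC piM -mulrA.
by rewrite mulrBr mulr1 -piM ff subrr mulr0.
Qed.

Lemma neq0_pi x : x != 0 -> exists i, pi i x != 0.
Proof.
move=> x0; apply/existsP; apply: contraR x0; rewrite negb_exists => /forallP x0.
apply/eqP/pi_inj => i; rewrite [RHS]linear0.
by apply/eqP/negbNE/x0.
Qed.

(** * The action of the antipode on the blocks *)

Variable Q : quasiHopf H.
Local Notation S := (antipode Q).
Hypothesis S2 : forall z, central z -> S (S z) = z.

Lemma antipode_eq0 x : S x = 0 -> x = 0.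
Proof.
by move=> Sx0; apply: (bij_inj (antipode_bij Q)); rewrite Sx0 linear0.
Qed.

Lemma antipode_block1C i : central (S (e i)).
Proof. by apply: (antipode_central k H Q); apply: block1_central. Qed.

Lemma pi_antipode_block1 i j : pi j (S (e i)) != 0 -> pi j (S (e i)) = 1.
Proof.
have [|->|//] := central_idempotent (S (e i)) j (antipode_block1C i).
  by rewrite -antipodeM -blockM mulr1.
by rewrite eqxx.
Qed.

(** Pick a block j where S(e_i) is nonzero, so S(e_i) e_j = e_j. Applying S gives S(e_j) e_i =
    S(e_j); hence S(e_j) lives in block i and equals e_i. One more S finishes. *)
Lemma antipode_block1 i : exists j, S (e i) = e j.
Proof.
have [j ij] : exists j, pi j (S (e i)) != 0.
  by apply: neq0_pi; apply: contraNneq (block1_neq0 i) => /antipode_eq0->.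
have Sij : S (e i) * e j = e j.
  apply: pi_inj => l; rewrite piM.
  have [<-|jl] := eqVneq j l; last by rewrite pi_block_neq ?mulr0.
  by rewrite (pi_antipode_block1 i j) // mul1r.
have Sji : S (e j) * e i = S (e j).
  by rewrite -[in RHS]Sij antipodeM S2 //; apply: block1_central.
have [l jl] : exists l, pi l (S (e j)) != 0.
  by apply: neq0_pi; apply: contraNneq (block1_neq0 j) => /antipode_eq0->.
have SjE : S (e j) = e i.
  apply: pi_inj => m; rewrite -Sji piM.
  have [<-|im] := eqVneq i m; last by rewrite pi_block_neq ?mulr0.
  have li : l = i.
    apply/eqP; apply: contraNT jl => li.
    by rewrite -Sji piM (pi_block_neq i l) ?mulr0 // eq_sym.
  by rewrite (pi_antipode_block1 j i) ?mul1r // -li.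
by exists j; rewrite -SjE S2 //; apply: block1_central.
Qed.

(** S(e_j x) = S(x) e_i, so block i of S(x) depends on block j of x alone. *)
Lemma pi_antipode i j x y :
  S (e j) = e i -> pi j x = pi j y -> pi i (S x) = pi i (S y).
Proof.
move=> Sj xy; have xE z : pi i (S z) = pi i (S (block j (pi j z))).
  by rewrite block_pi antipodeM piM Sj pi_block mulr1.
by rewrite xE xy -xE.
Qed.

(** [T] is known only through its components, so the blocks can be treated before a unit of H is
    assembled. *)
Lemma exists_block_involution :
  exists u : forall i, 'M[k]_((n i).+1),
    (forall i, u i \is a GRing.unit) /\
    forall T : H -> H, (forall i h, pi i (T h) = u i * pi i (S h) * (u i)^-1) ->
      involutive T.
Proof.
have [s sE] := fin_all_exists antipode_block1.
have sK : involutive s.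
  move=> i; apply/eqP; apply: contraT => ssi.
  have /eqP[] := block1_neq0 i; have := congr1 (pi i) (S2 _ (block1_central i)).
  rewrite !sE pi_block_neq // pi_block => /esym/eqP.
  by rewrite oner_eq0.
have sE' i : S (e (s i)) = e i by rewrite sE sK.
(* The order on indices breaks the symmetry of a pair {i, s i}: the larger index gets 1, the smaller
   one the matrix undoing S^2. *)
pose good i (v : 'M[k]_((n i).+1)) := v \is a GRing.unit /\
  if (s i < i)%N then v = 1 else
  if s i == i then forall h, v * pi i (S h) * v^-1 = (pi i h)^T
  else forall h, v * pi i (S (S h)) * v^-1 = pi i h.
have goodP i : exists v, good i v.
  rewrite /good; case: (ltnP (s i) i) => _; first by exists 1; rewrite unitr1.
  case: (s i =P i) => [si|_].
    (* Precomposing with transposition makes the order-reversing S multiplicative. *)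
    have phi_lin : linear (fun x : 'M[k]_((n i).+1) => pi i (S (block i x^T))).
      by move=> c x y; do !rewrite linearP /=.
    pose phi : {linear 'M[k]_((n i).+1) -> 'M[k]_((n i).+1)} :=
      HB.pack (fun x => pi i (S (block i x^T)))
        (GRing.isLinear.Build k _ _ _ _ phi_lin).
    have [||v vu vE] := matrix_endomorphism_inner k (n i) phi.
    - by rewrite /= trmx1 sE si pi_block.
    - by move=> x y; rewrite /= trmx_mul blockM antipodeM piM.
    exists v; split=> // h; rewrite -[RHS]vE /= trmxK.
    by congr (_ * _ * _); apply: (pi_antipode i i); rewrite ?sE ?si ?pi_block.
  have phi_lin : linear (fun x : 'M[k]_((n i).+1) => pi i (S (S (block i x)))).
    by move=> c x y; do !rewrite linearP /=.
  pose phi : {linear 'M[k]_((n i).+1) -> 'M[k]_((n i).+1)} :=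
    HB.pack (fun x => pi i (S (S (block i x))))
      (GRing.isLinear.Build k _ _ _ _ phi_lin).
  have [||v vu vE] := matrix_endomorphism_inner k (n i) phi.
  - by rewrite /= !sE sK pi_block.
  - by move=> x y; rewrite /= blockM !antipodeM piM.
  exists v; split=> // h; rewrite -[RHS]vE /=; congr (_ * _ * _).
  apply: (pi_antipode i (s i)) => //; apply: (pi_antipode (s i) i) => //.
  by rewrite pi_block.
have [u uP] := fin_all_exists goodP.
exists u; split=> [i|T TE h]; first by have [] := uP i.
apply: pi_inj => i; rewrite TE.
have [_] := uP i; have [_] := uP (s i); rewrite sK.
case: (ltngtP (s i) i) => [si|si|/val_inj si].
- rewrite -val_eqE /= gtn_eqF // => us ui.
  (* Write h = S(h'). As u_(s i) undoes S^2, T(h) and h' agree in block s i, so S(T(h)) and S(h') =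
     h agree in block i. *)
  have [S' _ S'K] := antipode_bij Q.
  rewrite ui mul1r invr1 mulr1 -{2}[h]S'K.
  by apply: (pi_antipode i (s i)) => //; rewrite TE -[in LHS](S'K h) us.
- rewrite -val_eqE /= gtn_eqF // => us ui.
  rewrite -[RHS]ui; congr (_ * _ * _); apply: (pi_antipode i (s i)) => //.
  by rewrite TE us mul1r invr1 mulr1.
- rewrite si eqxx => _ ui.
  by rewrite ui TE ui trmxK.
Qed.

End Blocks.

Theorem theorem6p4 (k : fieldType) (H : falgType k) (Q : quasiHopf H) :
  split_semisimple H ->
  exists (u : H) (Uu : u \is a GRing.unit),
    forall h : H,
      antipode (quasiHopf_twist Q Uu) (antipode (quasiHopf_twist Q Uu) h) = h.
Proof.
move=> [r [n [pi [g gK Kg]]]].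
have [e eI e1] := split_integral k H r n pi g gK Kg (counit Q).
have S2 z := antipode_sqr_central k H Q e eI z e1.
have [u [uU uT]] := exists_block_involution k H r n pi g gK Kg Q S2.
(* Conjugation by the glued element acts in block i as conjugation by [u i], which is what [uT] asks
   for. *)
pose v := glue k H r n g u.
have vE i : pi i v = u i by exact: pi_glue.
have vU : v \is a GRing.unit.
  apply/unitrP; exists (glue k H r n g (fun i => (u i)^-1)).
  split; apply: (pi_inj k H r n pi g gK) => i; rewrite (piM k H r n pi) vE.
    by rewrite (pi_glue k H r n pi g Kg) mulVr ?uU //; exact: esym (rmorph1 _).
  by rewrite (pi_glue k H r n pi g Kg) mulrV ?uU //; exact: esym (rmorph1 _).
have vVE i : pi i v^-1 = (u i)^-1 by rewrite -vE; apply: rmorphV.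
exists v, vU; apply: uT => i h.
by rewrite /= /antipode_conj !(piM k H r n pi) vVE vE.
Qed.
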